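(* Let $m\ge 0$, $\hbar>0$, $c>0$. (a) Lorentz covariance is compatible with the wave function being a strict scalar under Lorentz boosts: there exist wave equations $a^{\mu\nu}\partial_\mu\partial_\nu\Psi+b^\mu\partial_\mu\Psi+f\Psi=0$ that are Lorentz covariant, in the sense defined in the context, with all boost factors $g_{\mathbf v}\equiv1$, i.e. with $\Psi(x)=\Psi'(x')$ after every Lorentz boost. (b) If a wave equation is Lorentz covariant with all boost factors $g_{\mathbf v}\equiv 1$ and, in accordance with de Broglie's hypothesis ($E=\hbar\omega$, $\mathbf p=\hbar\mathbf k$) and the Einstein energy-momentum relation ($E^2=m^2c^4+p^2c^2$), every plane wave $e^{i(\mathbf k\cdot\mathbf r-\omega t)}$ with $\mathbf k\in\mathbb{R}^3$, $\omega\in\mathbb{R}$, $\hbar^2\omega^2=m^2c^4+c^2\hbar^2|\mathbf k|^2$ is a solution, then, up to an overall nonzero constant factor, it is the Klein-Gordon equation $$\partial_\mu\partial^\mu\Psi+\frac{m^2c^2}{\hbar^2}\Psi=0 .$$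
   Context: Notation: $x=(x^0,x^1,x^2,x^3)=(ct,\mathbf r)$, $\partial_\mu=\partial/\partial x^\mu$, metric $\mathrm{diag}(1,-1,-1,-1)$, so $\partial_\mu\partial^\mu=\frac{1}{c^2}\partial_t^2-\nabla^2$; repeated indices are summed. Wave equation: a homogeneous linear partial differential equation of order at most two of the form $L\Psi:=a^{\mu\nu}\partial_\mu\partial_\nu\Psi+b^\mu\partial_\mu\Psi+f\Psi=0$ for a complex-valued function $\Psi(x)$, with constant complex coefficients $a^{\mu\nu},b^\mu$ and an arbitrary function $f(x)$, which actually involves time derivatives (after combining $a^{\mu\nu}$ and $a^{\nu\mu}$). Frames: a rotation relates $S$ and $S'$ by $\mathbf r'=M\mathbf r$, $t'=t$, $M\in SO(3)$. A Lorentz boost with velocity $\mathbf v$, $|\mathbf v|=v<c$, along the $x^1$-axis is $x^0=\gamma(x^{0'}+\beta x^{1'})$, $x^1=\gamma(x^{1'}+\beta x^{0'})$, $x^2=x^{2'}$, $x^3=x^{3'}$ with $\beta=v/c$, $\gamma=1/\sqrt{1-\beta^2}$, and analogously (by conjugation with a rotation) for any direction of $\mathbf v$. The function $f$ is a strict scalar: $f'(x')=f(x)$. Under rotations wave functions transform as $\Psi(x)=\Psi'(x')$; under a boost with velocity $\mathbf v$ as $\Psi(x)=g_{\mathbf v}(x')\Psi'(x')$ with $g_{\mathbf v}$ a smooth, nowhere vanishing complex-valued function. Lorentz covariance: for every rotation and every Lorentz boost, substituting the transformation law into $L\Psi$ and expressing everything in primed variables gives, for every smooth $\Psi'$, a nowhere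 vanishing function (independent of $\Psi'$) times $a^{\mu\nu}\partial_{\mu'}\partial_{\nu'}\Psi'+b^\mu\partial_{\mu'}\Psi'+f'\Psi'$, with the same constants $a^{\mu\nu},b^\mu$. *)

(* Defs.v *)
(* MathComp / MathComp-Analysis; complex numbers are R[i] from real-closed. *)
From mathcomp Require Import all_boot all_order all_algebra.
From mathcomp Require Import complex.
From mathcomp Require Import all_classical all_reals all_analysis.

Set Implicit Arguments.
Unset Strict Implicit.
Unset Printing Implicit Defensive.

Import Order.TTheory GRing.Theory Num.Theory.
Import numFieldNormedType.Exports.
Local Open Scope ring_scope.
Local Open Scope complex_scope.

(* Events are column vectors (x^0, x^1, x^2, x^3) with x^0 = c t. *)
Notation spacetime R := 'cV[R]_4.
Notation wavefun R := ('cV[R]_4 -> R[i]).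

(* The library has no real normed-module structure on R[i], so complex-valued
   functions are differentiated through their real and imaginary parts. *)
Definition partial (R : realType) (mu : 'I_4) (Psi : wavefun R) : wavefun R :=
  fun x => ('D_(delta_mx mu 0) (fun y => complex.Re (Psi y)) x)
           +i* ('D_(delta_mx mu 0) (fun y => complex.Im (Psi y)) x).

Definition iter_partial (R : realType) (s : seq 'I_4) (Psi : wavefun R) :
  wavefun R := foldr (@partial R) Psi s.

(* C^oo: partial derivatives of every order exist and are (Frechet)
   differentiable, hence continuous, everywhere. *)
Definition smooth (R : realType) (Psi : wavefun R) : Prop :=
  forall (s : seq 'I_4) (x : spacetime R),
    differentiable (fun y => complex.Re (iter_partial s Psi y)) x /\
    differentiable (fun y => complex.Im (iter_partial s Psi y)) x.

Record wave_op (R : realType) := WaveOp {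
  coef_a : 'M[R[i]]_4;
  coef_b : 'cV[R[i]]_4;
  coef_f : wavefun R }.

Definition apply_op (R : realType) (L : wave_op R) (Psi : wavefun R) :
  wavefun R := fun x =>
  \sum_(mu < 4) \sum_(nu < 4)
     coef_a L mu nu * partial mu (partial nu Psi) x
  + \sum_(mu < 4) coef_b L mu 0 * partial mu Psi x
  + coef_f L x * Psi x.

Definition solution (R : realType) (L : wave_op R) (Psi : wavefun R) : Prop :=
  forall x, apply_op L Psi x = 0.

(* The mixed derivatives d_0 d_i and d_i d_0 are combined, so a time
   derivative occurs in them iff a^{0i} + a^{i0} is nonzero.  For mu = 0 the
   sum is 2 a^{00}. *)
Definition involves_time (R : realType) (L : wave_op R) : Prop :=
  (exists mu : 'I_4, coef_a L 0 mu + coef_a L mu 0 != 0) \/ coef_b L 0 0 != 0.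

Definition SO3 (R : realType) (M : 'M[R]_3) : Prop :=
  M^T *m M = 1%:M /\ \det M = 1.

Definition rot4 (R : realType) (M : 'M[R]_3) : 'M[R]_4 :=
  block_mx (1%:M : 'M[R]_1) 0 0 M : 'M[R]_(1 + 3).

(* Matrix B of x = B x' for the boost along the x^1-axis. *)
Definition boost1 (R : realType) (beta : R) : 'M[R]_4 :=
  let gamma := (Num.sqrt (1 - beta ^+ 2))^-1 in
  block_mx
    (block_mx (gamma%:M : 'M[R]_1) (gamma * beta)%:M
              (gamma * beta)%:M (gamma%:M : 'M[R]_1) : 'M[R]_(1 + 1))
    0 0 (1%:M : 'M[R]_2) : 'M[R]_(2 + 2).

(* The boost of speed v in the direction M e_1, M in SO(3), together with its
   velocity vector v M e_1; every velocity is of this form.  Two rotations M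
   with the same first column give the same boost, because rotations about
   the x^1-axis commute with boost1. *)
Definition boost (R : realType) (c : R) (M : 'M[R]_3) (v : R) : 'M[R]_4 :=
  rot4 M *m boost1 (v / c) *m rot4 M^T.

Definition velocity (R : realType) (M : 'M[R]_3) (v : R) : 'cV[R]_3 :=
  v *: col 0 M.

(* The operator in the primed frame, where x = A x': the constants are the
   same and f'(x') = f(x). *)
Definition primed_op (R : realType) (A : 'M[R]_4) (L : wave_op R) : wave_op R :=
  WaveOp (coef_a L) (coef_b L) (fun x' => coef_f L (A *m x')).

(* Covariance under x = A x' with Psi(x) = g(x') Psi'(x'). *)
Definition covariant_under (R : realType) (A : 'M[R]_4) (g : wavefun R)
    (L : wave_op R) : Prop :=
  exists lambda : wavefun R,
    (forall x', lambda x' != 0) /\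
    forall Psi' Psi : wavefun R, smooth Psi' ->
      (forall x', Psi (A *m x') = g x' * Psi' x') ->
      forall x', apply_op L Psi (A *m x') =
                 lambda x' * apply_op (primed_op A L) Psi' x'.

(* g assigns to each velocity vector its boost factor.  A rotation r' = M r
   reads x = rot4 M^T x', since M^T is the inverse of M. *)
Definition lorentz_covariant (R : realType) (c : R)
    (g : 'cV[R]_3 -> wavefun R) (L : wave_op R) : Prop :=
  (forall M : 'M[R]_3, SO3 M -> covariant_under (rot4 M^T) (fun=> 1) L) /\
  (forall (M : 'M[R]_3) (v : R), SO3 M -> 0 <= v < c ->
     [/\ smooth (g (velocity M v)),
         forall x', g (velocity M v) x' != 0 &
         covariant_under (boost c M v) (g (velocity M v)) L]).

Definition sqnorm3 (R : realType) (k : 'cV[R]_3) : R :=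
  \sum_(i < 3) k i 0 ^+ 2.

(* exp (i (k.r - omega t)), with t = x^0 / c. *)
Definition plane_wave (R : realType) (c : R) (k : 'cV[R]_3) (omega : R) :
  wavefun R := fun x =>
  let theta := \sum_(i < 3) k i 0 * x (lift ord0 i) 0 - omega * (x 0 0 / c) in
  cos theta +i* sin theta.

Definition minkowski (R : realType) (mu nu : 'I_4) : R :=
  if mu == nu then (if mu == 0 then 1 else -1) else 0.

Definition dalembertian (R : realType) (Psi : wavefun R) : wavefun R :=
  fun x => \sum_(mu < 4) \sum_(nu < 4)
    (minkowski R mu nu)%:C * partial mu (partial nu Psi) x.

Definition klein_gordon (R : realType) (m hbar c : R) (Psi : wavefun R) :
  wavefun R := fun x =>
  dalembertian Psi x + (m ^+ 2 * c ^+ 2 / hbar ^+ 2)%:C * Psi x.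

(* Main.v *)
(* (a) If A eta A^T = eta and B = A^-1, the chain rule turns the second-order
   symbol eta of the d'Alembertian into B eta B^T = eta, so the d'Alembertian
   itself is a covariant operator.
   (b) On the plane wave with wave covector k the operator acts as
   multiplication by -a(k,k) + i b.k + f(x), which therefore vanishes on the
   whole hyperboloid k_0^2 = M + |k|^2 with M = (m c / hbar)^2.  Comparing a few
   of its points forces b = 0, f = M a^{00} and the symmetric part of a to be
   a^{00} eta.  The antisymmetric part of a acts trivially because partial
   derivatives commute. *)
Require Import Defs.
From mathcomp Require Import all_boot all_order all_algebra.
From mathcomp Require Import complex.
From mathcomp Require Import all_classical all_reals all_analysis.
From mathcomp Require Import ring.
Import Order.TTheory GRing.Theory Num.Theory.
Import numFieldNormedType.Exports.
Local Open Scope ring_scope.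
Local Open Scope complex_scope.

(** * Symmetry of mixed directional derivatives *)

Section MixedDerivatives.
Context {R : realType} {V : normedModType R}.
Implicit Types (f : V -> R) (x u v : V).

(** Along a line, the difference quotients of [f] in direction [v] are those of a function of one
    real variable, so that [MVT] becomes applicable. *)
Lemma is_derive_line f x v t : derivable f (x + t *: v) v ->
  is_derive t 1 (fun s => f (x + s *: v)) ('D_v f (x + t *: v)).
Proof.
have E : (fun h => h^-1 *: (((fun s => f (x + s *: v)) \o shift t) (h *: 1)
              - f (x + t *: v))) =
         (fun h : R => h^-1 *: ((f \o shift (x + t *: v)) (h *: v)
              - f (x + t *: v))).
  apply/funext => h /=; congr (_ *: (f _ - _)).
  by rewrite [h *: 1]mulr1 scalerDl addrCA.
move=> df; apply: DeriveDef; first by rewrite /derivable E.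
by rewrite /derive E.
Qed.

Lemma directional_MVT f x v (h : R) : 0 < h ->
  (forall y, derivable f y v) ->
  exists2 t, 0 < t < h & f (x + h *: v) - f x = h * 'D_v f (x + t *: v).
Proof.
move=> h0 df.
have df1 t := is_derive_line f x v t (df _).
have [|t] := @MVT R (fun s => f (x + s *: v)) _ 0 h h0 (fun t _ => df1 t).
  apply: continuous_subspaceT => t.
  apply/differentiable_continuous/derivable1_diffP.
  by have [] := df1 t.
rewrite in_itv /= => ht; rewrite scale0r addr0 subr0 => ->.
by exists t; rewrite // mulrC.
Qed.

Lemma is_derive_translate f x v a : derivable f (x + a) v ->
  is_derive x v (fun y => f (y + a)) ('D_v f (x + a)).
Proof.
have E : (fun h => h^-1 *: (((fun y => f (y + a)) \o shift x) (h *: v)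
              - f (x + a))) =
         (fun h : R => h^-1 *: ((f \o shift (x + a)) (h *: v) - f (x + a))).
  by apply/funext => h /=; rewrite addrA.
move=> df; apply: DeriveDef; first by rewrite /derivable E.
by rewrite /derive E.
Qed.

(** The mean value theorem is applied twice: along [u] to [phi], the increment of [f] under
    translation by [h *: v], then along [v] to ['D_u f]. *)
Lemma second_difference_MVT f x u v (h : R) : 0 < h ->
  (forall y, derivable f y u) -> (forall y, derivable ('D_u f) y v) ->
  exists s t, [/\ 0 < s < h, 0 < t < h &
    f (x + h *: u + h *: v) - f (x + h *: u) - (f (x + h *: v) - f x)
    = h * h * 'D_v ('D_u f) (x + s *: u + t *: v)].
Proof.
move=> h0 duf dvuf.
pose phi y := f (y + h *: v) - f y.
have dphi y : derivable phi y u /\ 'D_u phi y = 'D_u f (y + h *: v) - 'D_u f y.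
  have [dt Et] := is_derive_translate f y u (h *: v) (duf _).
  by split; [exact: derivableB | rewrite deriveB// Et].
have [s hs] :=
  directional_MVT phi x u h h0 (fun y => (dphi y).1).
rewrite (dphi _).2 /phi.
have [t ht ->] := directional_MVT ('D_u f) (x + s *: u) v h h0 dvuf.
by move=> E; exists s, t; split=> //; rewrite E mulrA.
Qed.

(** If the values at [x] differed, continuity would keep each function near [x] within half their
    distance of its value at [x]; a common value taken there contradicts the triangle inequality. *)
Lemma eq_of_near_eq (g1 g2 : V -> R) x u v :
  {for x, continuous g1} -> {for x, continuous g2} ->
  (forall h : R, 0 < h -> exists s t s' t',
    [/\ 0 < s < h, 0 < t < h, 0 < s' < h, 0 < t' < h &
     g1 (x + s *: u + t *: v) = g2 (x + s' *: u + t' *: v)]) ->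
  g1 x = g2 x.
Proof.
move=> c1 c2 near_eq; apply/eqP/contraT => neq.
have e0 : 0 < `|g1 x - g2 x| / 2.
  by rewrite divr_gt0// normr_gt0 subr_eq0.
move/cvgrPdist_lt: c1 => /(_ _ e0) /nbhs_normP[d1 /= d10 H1].
move/cvgrPdist_lt: c2 => /(_ _ e0) /nbhs_normP[d2 /= d20 H2].
pose d := Num.min d1 d2.
have d0 : 0 < d by rewrite lt_min d10.
(* All points used in the parallelogram spanned by [h *: u] and [h *: v] are then within [d] of [x];
   the summand 1 keeps the denominator positive and the bound strict. *)
pose h := d / (`|u| + `|v| + 1).
have D0 : 0 < `|u| + `|v| + 1 by rewrite ltr_wpDl// addr_ge0.
have h0 : 0 < h by rewrite divr_gt0.
have near_x a b : 0 < a < h -> 0 < b < h -> `|x - (x + a *: u + b *: v)| < d.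
  move=> /andP[a0 ah] /andP[b0 bh]; rewrite -addrA opprD addNKr normrN.
  rewrite (le_lt_trans (ler_normD _ _))// !normrZ !gtr0_norm//.
  have -> : d = h * (`|u| + `|v| + 1) by rewrite /h divfK// gt_eqF.
  rewrite !mulrDr mulr1; apply: (@le_lt_trans _ _ (h * `|u| + h * `|v|)).
    by rewrite lerD// ler_wpM2r// ltW.
  by rewrite ltrDl.
have [s [t [s' [t' [hs ht hs' ht' E]]]]] := near_eq h h0.
have /H1 A : `|x - (x + s *: u + t *: v)| < d1.
  by rewrite (lt_le_trans (near_x _ _ hs ht))// ge_min lexx.
have /H2 B : `|x - (x + s' *: u + t' *: v)| < d2.
  by rewrite (lt_le_trans (near_x _ _ hs' ht'))// ge_min lexx orbT.
have := ler_distD (g2 (x + s' *: u + t' *: v)) (g1 x) (g2 x).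
by rewrite leNgt [ltRHS]splitr ltrD// -?E// distrC E.
Qed.

(** Schwarz's theorem: the second difference over a small parallelogram is [h * h] times a nearby
    value of either mixed derivative, for arbitrarily small [h]. *)
Lemma derive_comm f u v x :
  (forall y, derivable f y u) -> (forall y, derivable f y v) ->
  (forall y, derivable ('D_u f) y v) -> (forall y, derivable ('D_v f) y u) ->
  {for x, continuous ('D_v ('D_u f))} ->
  {for x, continuous ('D_u ('D_v f))} ->
  'D_v ('D_u f) x = 'D_u ('D_v f) x.
Proof.
move=> du dv dvu duv c1 c2; apply: (eq_of_near_eq _ _ x u v c1 c2) => h h0.
have [s [t [hs ht]]] := second_difference_MVT f x u v h h0 du dvu.
have [t' [s' [ht' hs']]] := second_difference_MVT f x v u h h0 dv duv.
rewrite (addrAC x (t' *: v)) (addrAC x (h *: v)).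
move=> Evu Euv; exists s, t, s', t'.
split; [exact: hs|exact: ht|exact: hs'|exact: ht'|].
apply: (mulfI (mulf_neq0 (lt0r_neq0 h0) (lt0r_neq0 h0))).
(* Exchanging [u] and [v] only swaps the terms [q] and [r] of the second difference. *)
have swap (p q r w : R) : p - q - (r - w) = p - r - (q - w) by ring.
exact: etrans (esym Euv) (etrans (swap _ _ _ _) Evu).
Qed.
End MixedDerivatives.

(** * Partial derivatives of complex-valued functions *)

Section ComplexCalculus.
Context {R : realType}.
Implicit Types (F G : wavefun R) (x : spacetime R) (z : R[i]).

Definition cdifferentiable F x :=
  differentiable (fun y => complex.Re (F y)) x /\
  differentiable (fun y => complex.Im (F y)) x.

Lemma smooth_cdifferentiable F x : smooth F -> cdifferentiable F x.
Proof. by move=> /(_ [::] x). Qed.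

(** [iter_partial] applies the last index of its list first, so the derivatives of [partial mu F]
    along [s] are those of [F] along [rcons s mu]. *)
Lemma smooth_partial mu F : smooth F -> smooth (partial mu F).
Proof.
move=> sF s x; have := sF (rcons s mu) x.
by rewrite /iter_partial foldr_rcons.
Qed.

Lemma partial_comm F mu nu x : smooth F ->
  partial mu (partial nu F) x = partial nu (partial mu F) x.
Proof.
move=> sF; have c2 a b y := smooth_cdifferentiable (partial a (partial b F)) y
  (smooth_partial _ _ (smooth_partial _ _ sF)).
have c1 a y := smooth_cdifferentiable (partial a F) y (smooth_partial _ _ sF).
have c0 y := smooth_cdifferentiable F y sF.
have re := derive_comm (fun y => complex.Re (F y)) _ _ x
  (fun y => diff_derivable (c0 y).1) (fun y => diff_derivable (c0 y).1)
  (fun y => diff_derivable (c1 nu y).1) (fun y => diff_derivable (c1 mu y).1)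
  (differentiable_continuous (c2 mu nu x).1)
  (differentiable_continuous (c2 nu mu x).1).
have im := derive_comm (fun y => complex.Im (F y)) _ _ x
  (fun y => diff_derivable (c0 y).2) (fun y => diff_derivable (c0 y).2)
  (fun y => diff_derivable (c1 nu y).2) (fun y => diff_derivable (c1 mu y).2)
  (differentiable_continuous (c2 mu nu x).2)
  (differentiable_continuous (c2 nu mu x).2).
exact: (f_equal2 (@Complex R) re im).
Qed.

Lemma Re_mul z1 z2 : complex.Re (z1 * z2) =
  complex.Re z1 * complex.Re z2 - complex.Im z1 * complex.Im z2 :> R.
Proof. by case: z1 z2 => ? ? []. Qed.

Lemma Im_mul z1 z2 : complex.Im (z1 * z2) =
  complex.Re z1 * complex.Im z2 + complex.Im z1 * complex.Re z2 :> R.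
Proof. by case: z1 z2 => ? ? []. Qed.

Lemma cdifferentiableD F G x : cdifferentiable F x -> cdifferentiable G x ->
  cdifferentiable (fun y => F y + G y) x.
Proof.
move=> [F1 F2] [G1 G2]; split.
  rewrite (_ : (fun y => _) =
    (fun y => complex.Re (F y)) + (fun y => complex.Re (G y))).
    exact: differentiableD.
  by apply/funext => y; rewrite raddfD.
rewrite (_ : (fun y => _) =
    (fun y => complex.Im (F y)) + (fun y => complex.Im (G y))).
  exact: differentiableD.
by apply/funext => y; rewrite raddfD.
Qed.

Lemma partialD mu F G x : cdifferentiable F x -> cdifferentiable G x ->
  partial mu (fun y => F y + G y) x = partial mu F x + partial mu G x.
Proof.
move=> [F1 F2] [G1 G2]; rewrite /partial.
rewrite (_ : (fun y => complex.Re _) =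
    (fun y => complex.Re (F y)) + (fun y => complex.Re (G y))); last first.
  by apply/funext => y; rewrite raddfD.
rewrite (_ : (fun y => complex.Im _) =
    (fun y => complex.Im (F y)) + (fun y => complex.Im (G y))); last first.
  by apply/funext => y; rewrite raddfD.
by rewrite !deriveD//; exact: diff_derivable.
Qed.

Let Re_scale z F : (fun y => complex.Re (z * F y)) =
  complex.Re z *: (fun y => complex.Re (F y)) +
  (- complex.Im z) *: (fun y => complex.Im (F y)).
Proof. by apply/funext => y; rewrite Re_mul -mulNr. Qed.

Let Im_scale z F : (fun y => complex.Im (z * F y)) =
  complex.Re z *: (fun y => complex.Im (F y)) +
  complex.Im z *: (fun y => complex.Re (F y)).
Proof. by apply/funext => y; rewrite Im_mul. Qed.

Lemma cdifferentiableZ z F x :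
  cdifferentiable F x -> cdifferentiable (fun y => z * F y) x.
Proof.
move=> [F1 F2]; split.
  by rewrite Re_scale; apply: differentiableD; exact: differentiableZ.
by rewrite Im_scale; apply: differentiableD; exact: differentiableZ.
Qed.

Let deriveZD (f g : spacetime R -> R) (a b : R) x v :
  derivable f x v -> derivable g x v ->
  'D_v (a *: f + b *: g) x = a * 'D_v f x + b * 'D_v g x.
Proof.
move=> df dg; rewrite deriveD; [|exact: derivableZ|exact: derivableZ].
by rewrite (deriveZ a df) (deriveZ b dg).
Qed.

Lemma partialZ mu z F x : cdifferentiable F x ->
  partial mu (fun y => z * F y) x = z * partial mu F x.
Proof.
move=> [F1 F2]; have D1 := diff_derivable (v := delta_mx mu 0) F1.
have D2 := diff_derivable (v := delta_mx mu 0) F2.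
rewrite /partial Re_scale Im_scale.
rewrite (deriveZD _ _ _ _ _ _ D1 D2) (deriveZD _ _ _ _ _ _ D2 D1).
move: ('D_ _ _ x) ('D_ _ _ x) => d1 d2.
by case: z => a b; rewrite mulNr.
Qed.

Lemma cdifferentiable_cst z x : cdifferentiable (fun=> z) x.
Proof. by split; exact: differentiable_cst. Qed.

Lemma partial_cst mu z : partial mu (fun=> z) = fun=> 0 :> R[i].
Proof. by apply/funext => x; rewrite /partial !derive_cst. Qed.

Lemma smooth_cst z : smooth (fun=> z).
Proof.
move=> s x; suff [w ->] : exists w, iter_partial s (fun=> z) = fun=> w.
  exact: cdifferentiable_cst.
by elim: s => [|mu s [w /= ->]]; [exists z | exists 0; rewrite partial_cst].
Qed.

Lemma cdifferentiable_sum n (c : 'I_n -> R[i]) (F : 'I_n -> wavefun R) x :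
  (forall i, cdifferentiable (F i) x) ->
  cdifferentiable (fun y => \sum_(i < n) c i * F i y) x.
Proof.
elim: n c F => [|n IH] c F dF.
  rewrite (_ : (fun y => _) = fun=> 0); first exact: cdifferentiable_cst.
  by apply/funext => y; rewrite big_ord0.
rewrite (_ : (fun y => _) = fun y => c ord0 * F ord0 y +
    \sum_(i < n) c (lift ord0 i) * F (lift ord0 i) y); last first.
  by apply/funext => y; rewrite big_ord_recl.
by apply: cdifferentiableD; [exact: cdifferentiableZ | exact: IH].
Qed.

Lemma partial_sum mu n (c : 'I_n -> R[i]) (F : 'I_n -> wavefun R) x :
  (forall i, cdifferentiable (F i) x) ->
  partial mu (fun y => \sum_(i < n) c i * F i y) x =
  \sum_(i < n) c i * partial mu (F i) x.
Proof.
elim: n c F => [|n IH] c F dF.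
  rewrite (_ : (fun y => _) = fun=> 0); first by rewrite partial_cst big_ord0.
  by apply/funext => y; rewrite big_ord0.
rewrite (_ : (fun y => _) = fun y => c ord0 * F ord0 y +
    \sum_(i < n) c (lift ord0 i) * F (lift ord0 i) y); last first.
  by apply/funext => y; rewrite big_ord_recl.
rewrite partialD; [|exact: cdifferentiableZ|exact: cdifferentiable_sum].
by rewrite partialZ// IH// big_ord_recl.
Qed.

Lemma derive_comp_linear (f : spacetime R -> R) (B : 'M[R]_4) (v x : spacetime R) :
  'D_v (fun y => f (B *m y)) x = 'D_(B *m v) f (B *m x).
Proof.
have E : (fun h : R => h^-1 *: (((fun y => f (B *m y)) \o shift x) (h *: v)
              - f (B *m x))) =
         (fun h : R => h^-1 *: ((f \o shift (B *m x)) (h *: (B *m v))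
              - f (B *m x))).
  by apply/funext => h /=; rewrite mulmxDr scalemxAr.
by rewrite /derive E.
Qed.

Lemma derive_col (f : spacetime R -> R) (v x : spacetime R) :
  differentiable f x ->
  'D_v f x = \sum_(a < 4) v a 0 * 'D_(delta_mx a 0) f x.
Proof.
move=> df; rewrite deriveE// {1}(matrix_sum_delta v) linear_sum/=.
apply: eq_bigr => a _.
by rewrite big_ord1 linearZ/= deriveE.
Qed.

(** Chain rule: the basis vector [mu] is sent to column [mu] of [B], and the differential of [F] is
    linear in the direction. *)
Lemma partial_comp_linear mu (B : 'M[R]_4) F x :
  cdifferentiable F (B *m x) ->
  partial mu (fun y => F (B *m y)) x =
  \sum_(a < 4) (B a mu)%:C * partial a F (B *m x).
Proof.
move=> [F1 F2]; rewrite /partial.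
rewrite (derive_comp_linear (fun y => complex.Re (F y))).
rewrite (derive_comp_linear (fun y => complex.Im (F y))).
rewrite !derive_col//.
have Bcol a : (B *m delta_mx mu 0) a 0 = B a mu :> R.
  rewrite mxE (bigD1 mu)//= mxE !eqxx mulr1 big1 ?addr0// => k /negbTE kmu.
  by rewrite mxE kmu mulr0.
apply/eqP; rewrite eq_complex/= !raddf_sum/=; apply/andP; split; apply/eqP.
  by apply: eq_bigr => a _; rewrite Bcol mul0r subr0.
by apply: eq_bigr => a _; rewrite Bcol mul0r addr0.
Qed.

(** In matrix form, two uses of the chain rule turn the Hessian [D] of [F] into [B^T *m D *m B]. *)
Lemma partial2_comp_linear mu nu (B : 'M[R]_4) F x : smooth F ->
  partial mu (partial nu (fun y => F (B *m y))) x =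
  \sum_(b < 4) \sum_(a < 4)
    (B b nu)%:C * (B a mu)%:C * partial a (partial b F) (B *m x).
Proof.
move=> sF.
have dF a y : cdifferentiable (partial a F) y.
  by apply: smooth_cdifferentiable; exact: smooth_partial.
pose G w := \sum_(b < 4) (B b nu)%:C * partial b F w.
have -> : partial nu (fun y => F (B *m y)) = fun y => G (B *m y).
  apply/funext => y; rewrite partial_comp_linear//.
  exact: smooth_cdifferentiable.
rewrite (partial_comp_linear mu B G); last exact: cdifferentiable_sum.
rewrite exchange_big; apply: eq_bigr => a _.
rewrite partial_sum// mulr_sumr; apply: eq_bigr => b _.
by rewrite mulrA [X in X * _]mulrC.
Qed.

End ComplexCalculus.

(** * Lorentz invariance of the d'Alembertian *)

Section LorentzInvariance.
Context {R : realType}.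
Implicit Types (A : 'M[R]_4) (M : 'M[R]_3).

(* The bare name minkowski now denotes Minkowski's inequality of
   MathComp-Analysis. *)
Definition eta : 'M[R]_4 := \matrix_(mu, nu) Defs.minkowski R mu nu.

Definition lorentz A := A *m eta *m A^T = eta.

(** The split into time and space fits the blocks of [rot4]. *)
Lemma eta_block13 : eta = block_mx (1%:M : 'M[R]_1) 0 0 (- 1%:M : 'M[R]_3)
  :> 'M[R]_(1 + 3).
Proof.
apply/matrixP => i j; rewrite [eta]lock.
have [k ->|k ->] := @split_ordP 1 3 i; have [l ->|l ->] := @split_ordP 1 3 j.
- rewrite block_mxEul -lock !mxE !ord1 /Defs.minkowski.
  by rewrite !eqxx.
- by rewrite block_mxEur -lock !mxE ord1.
- by rewrite block_mxEdl -lock !mxE ord1.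
rewrite block_mxEdr -lock !mxE /Defs.minkowski.
rewrite -!val_eqE /= ?addSn ?add0n ?eqSS.
by case: (_ == _); rewrite //= ?oppr0.
Qed.

(** The split into the boost plane and the transverse plane fits the blocks of [boost1]. *)
Lemma eta_block22 : eta = block_mx (block_mx 1%:M 0 0 (- 1%:M) : 'M[R]_(1 + 1)) 0
  0 (- 1%:M : 'M[R]_2) :> 'M[R]_(2 + 2).
Proof.
apply/matrixP => i j; rewrite [eta]lock.
have [k ->|k ->] := @split_ordP 2 2 i; have [l ->|l ->] := @split_ordP 2 2 j.
- rewrite block_mxEul -lock.
  rewrite [eta]lock.
  have [k' ->|k' ->] := @split_ordP 1 1 k; have [l' ->|l' ->] := @split_ordP 1 1 l;
    rewrite !ord1.
  + by rewrite (@block_mxEul _ 1 1 1 1) -lock !mxE.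
  + by rewrite (@block_mxEur _ 1 1 1 1) -lock !mxE.
  + by rewrite (@block_mxEdl _ 1 1 1 1) -lock !mxE.
  + by rewrite (@block_mxEdr _ 1 1 1 1) -lock !mxE.
- rewrite block_mxEur -lock !mxE /Defs.minkowski -val_eqE /=.
  by rewrite ltn_eqF// (leq_trans (ltn_ord k))// leq_addr.
- rewrite block_mxEdl -lock !mxE /Defs.minkowski -val_eqE /=.
  by rewrite eq_sym ltn_eqF// (leq_trans (ltn_ord l))// leq_addr.
rewrite block_mxEdr -lock !mxE /Defs.minkowski.
rewrite -!val_eqE /= ?addSn ?add0n ?eqSS.
by case: (_ == _); rewrite //= ?oppr0.
Qed.

Lemma eta_sq : eta *m eta = 1%:M.
Proof.
rewrite eta_block13 (@mulmx_block _ 1 3 1 3 1 3).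
rewrite !(mulmx0, mul0mx, addr0, add0r, mulmx1, mul1mx).
by rewrite mulNmx mulmxN mul1mx opprK -scalar_mx_block.
Qed.

Lemma lorentzM A B : lorentz A -> lorentz B -> lorentz (A *m B).
Proof.
rewrite /lorentz => lA lB; rewrite trmx_mul !mulmxA.
by rewrite -[A *m B *m eta]mulmxA -[A *m _ *m B^T]mulmxA lB.
Qed.

Lemma lorentz_rot4 M : M *m M^T = 1%:M -> lorentz (rot4 M).
Proof.
move=> orthM; rewrite /lorentz /rot4 eta_block13.
rewrite (@tr_block_mx _ 1 3 1 3) !(@mulmx_block _ 1 3 1 3 1 3).
rewrite !(mulmx0, mul0mx, addr0, add0r, mulmx1, mul1mx, trmx0, trmx1).
by rewrite mulmxN mulmx1 mulNmx orthM.
Qed.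

Lemma lorentz_boost1 (beta : R) : beta ^+ 2 < 1 -> lorentz (boost1 beta).
Proof.
move=> hb; rewrite /lorentz /boost1 eta_block22.
set g := (Num.sqrt _)^-1.
(* This is gamma^2 (1 - beta^2) = 1, the only relation between the boost entries that is needed. *)
have gE : g * g - g * beta * (g * beta) = 1.
  have -> : g * g - g * beta * (g * beta) = g ^+ 2 * (1 - beta ^+ 2) by ring.
  rewrite /g exprVn sqr_sqrtr ?subr_ge0 ?(ltW hb)// mulVf//.
  by rewrite subr_eq0 eq_sym (lt_eqF hb).
rewrite (@tr_block_mx _ 2 2 2 2) (@tr_block_mx _ 1 1 1 1).
rewrite !(@mulmx_block _ 2 2 2 2 2 2) !(@mulmx_block _ 1 1 1 1 1 1).
rewrite !(mulmx0, mul0mx, addr0, add0r, mulmx1, mul1mx, trmx0, trmx1).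
rewrite !tr_scalar_mx !mulmxN !mulmx1 (@mulmx_block _ 1 1 1 1 1 1).
rewrite !mulNmx -!scalar_mxM.
rewrite -!raddfN -!raddfD/= gE [g * beta * g]mulrC subrr.
have -> : g * beta * (g * beta) - g * g = -1 by rewrite -gE opprB.
by rewrite raddf0 raddfN.
Qed.

Lemma lorentz_boost (c : R) M v : 0 < c -> SO3 M -> 0 <= v < c ->
  lorentz (boost c M v).
Proof.
move=> c0 [MtM _] /andP[v0 vc]; rewrite /boost.
apply: lorentzM; [apply: lorentzM|].
- by apply: lorentz_rot4; rewrite mulmx1C.
- apply: lorentz_boost1; rewrite expr_lt1// ?divr_ge0 ?(ltW c0)//.
  by rewrite ltr_pdivrMr// mul1r.
- by apply: lorentz_rot4; rewrite trmxK.
Qed.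

(** The witness for part (a), the massless wave operator; since its [f] is zero, [primed_op] leaves
    it unchanged. *)
Definition dalembertian_op : wave_op R :=
  WaveOp (map_mx (real_complex R) eta) 0 (fun=> 0).

Lemma apply_dalembertian_op (F : wavefun R) x :
  apply_op dalembertian_op F x = \sum_(mu < 4) \sum_(nu < 4)
    map_mx (real_complex R) eta mu nu * partial mu (partial nu F) x.
Proof.
rewrite /apply_op; set S := (X in X + _ + _).
by rewrite [X in _ + X]mul0r addr0 big1 ?addr0// => mu _; rewrite mxE mul0r.
Qed.

(** Written as a trace, the contraction of coefficients with the Hessian can be permuted cyclically,
    which moves the transformation matrices onto the coefficients. *)
Lemma mxtrace_mul_tr (K : comPzRingType) n (X Y : 'M[K]_n) :
  \sum_(i < n) \sum_(j < n) X i j * Y i j = \tr (X *m Y^T).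
Proof.
apply: eq_bigr => i _; rewrite mxE; apply: eq_bigr => j _.
by rewrite mxE.
Qed.

Lemma covariant_dalembertian A : lorentz A ->
  covariant_under A (fun=> 1) dalembertian_op.
Proof.
(* The inverse of [A] is read off from [A *m eta *m A^T = eta] by multiplying by [eta] on the
   right. *)
move=> lA; pose B := eta *m A^T *m eta.
have AB : A *m B = 1%:M by rewrite /B !mulmxA lA eta_sq.
have BA : B *m A = 1%:M := mulmx1C AB.
have lB : B *m eta *m B^T = eta.
  rewrite {1}/B -[_ *m eta *m eta]mulmxA eta_sq mulmx1.
  rewrite /B !trmx_mul trmxK.
  have -> : eta^T = eta.
    by apply/matrixP => i j; rewrite !mxE /Defs.minkowski eq_sym; case: eqP => [->|].
  by rewrite !mulmxA -[RHS]mul1mx -BA.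
exists (fun=> 1); split=> [x'|F' F sF' F'E x']; first exact: oner_neq0.
have {F'E}-> : F = fun y => F' (B *m y).
  by apply/funext => y; rewrite -[F' _]mul1r -F'E mulmxA AB mul1mx.
rewrite mul1r -[primed_op _ _]/dalembertian_op !apply_dalembertian_op.
pose D : 'M[R[i]]_4 := \matrix_(a, b) partial a (partial b F') x'.
pose BC := map_mx (real_complex R) B; pose etaC := map_mx (real_complex R) eta.
(* The Hessian of [F] is expressed by the Hessian [D] of [F']; cyclicity then collects
   [BC *m etaC *m BC^T], which equals [etaC] by [lB]. *)
transitivity (\tr (etaC *m (BC^T *m D *m BC)^T)).
  rewrite -mxtrace_mul_tr; apply: eq_bigr => mu _; apply: eq_bigr => nu _.
  rewrite partial2_comp_linear// !mulmxA BA mul1mx; congr (_ * _); rewrite [RHS]mxE.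
  apply: eq_bigr => b _; rewrite [in RHS]mxE mulr_suml; apply: eq_bigr => a _.
  by rewrite !mxE; ring.
rewrite !trmx_mul trmxK !mulmxA mxtrace_mulC !mulmxA.
have -> : BC *m etaC *m BC^T = etaC.
  have -> : BC^T = map_mx (real_complex R) B^T.
    by apply/matrixP => i j; rewrite !mxE.
  by rewrite -!map_mxM lB.
rewrite -mxtrace_mul_tr; apply: eq_bigr => mu _; apply: eq_bigr => nu _.
by rewrite [D _ _]mxE.
Qed.

End LorentzInvariance.

(** * Plane waves *)

Section PlaneWaves.
Context {R : realType}.
Implicit Types (k : 'cV[R]_3) (x : spacetime R).

(** Covariant components: with x^0 = ct and time component -omega/c, the phase k.r - omega t is the
    plain pairing [phase], without a metric. *)
Definition wave_covector (c : R) k omega : 'cV[R]_4 :=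
  \col_mu (if unlift ord0 mu is Some i then k i 0 else - (omega / c)).

Definition phase (kap x : spacetime R) : R :=
  \sum_(mu < 4) kap mu 0 * x mu 0.

Definition expi (kap : spacetime R) : wavefun R :=
  fun x => cos (phase kap x) +i* sin (phase kap x).

Lemma plane_wave_expi c k omega :
  plane_wave c k omega = expi (wave_covector c k omega).
Proof.
apply/funext => x; rewrite /plane_wave /expi.
suff -> : phase (wave_covector c k omega) x =
  \sum_(i < 3) k i 0 * x (lift ord0 i) 0 - omega * (x 0 0 / c) by [].
rewrite /phase big_ord_recl mxE unlift_none addrC; congr (_ + _).
  by apply: eq_bigr => i _; rewrite mxE liftK.
by rewrite mulNr -!mulrA [c^-1 * _]mulrC.
Qed.

Lemma phaseD kap x y : phase kap (x + y) = phase kap x + phase kap y.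
Proof.
by rewrite /phase -big_split; apply: eq_bigr => mu _; rewrite mxE mulrDr.
Qed.

Lemma phaseZ kap (a : R) x : phase kap (a *: x) = a * phase kap x.
Proof.
by rewrite /phase mulr_sumr; apply: eq_bigr => mu _; rewrite mxE mulrCA.
Qed.

Lemma phase_delta kap mu : phase kap (delta_mx mu 0) = kap mu 0.
Proof.
rewrite /phase (bigD1 mu)//= mxE !eqxx mulr1 big1 ?addr0// => nu /negbTE nm.
by rewrite mxE nm mulr0.
Qed.

Lemma differentiable_phase kap x : differentiable (phase kap) x.
Proof.
have -> : phase kap = \sum_(nu < 4) (kap nu 0 *: (fun y : spacetime R => y nu 0)).
  by apply/funext => y; rewrite fct_sumE.
apply: differentiable_sum => nu.
by apply: differentiableZ; exact: differentiable_coord.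
Qed.

(** The phase is affine along the line through [x] in direction [v], so the one-variable chain rule
    at 0 suffices. *)
Lemma derive_comp_phase (phi : R -> R) (d : R) kap x (v : spacetime R) :
  is_derive (phase kap x) 1 phi d ->
  'D_v (fun y => phi (phase kap y)) x = d * phase kap v.
Proof.
move=> dphi.
have E : (fun h : R => h^-1 *: (((fun y => phi (phase kap y)) \o shift x) (h *: v)
              - phi (phase kap x))) =
         (fun h : R => h^-1 *:
           ((phi \o (fun t => phase kap x + t * phase kap v)) (h *: 1 + 0)
              - (phi \o (fun t => phase kap x + t * phase kap v)) 0)).
  apply/funext => h /=; rewrite phaseD phaseZ addr0 mul0r addr0 [h *: 1]mulr1.
  by rewrite [h * _ + _]addrC.
have d1 : is_derive (0 : R) 1 (fun t => phase kap x + t * phase kap v) (phase kap v).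
  by apply: is_derive_eq; rewrite add0r mul1r scaler0 add0r [_ *: 1]mulr1.
have d0 : is_derive (phase kap x + 0 * phase kap v) 1 phi d.
  by rewrite mul0r addr0.
have := is_derive1_comp (g := fun t => phase kap x + t * phase kap v) d0 d1.
by move=> [_ <-]; rewrite /derive E.
Qed.

Lemma cdifferentiable_expi kap x : cdifferentiable (expi kap) x.
Proof.
split.
  apply: (@differentiable_comp _ _ _ _ (phase kap) cos).
    exact: differentiable_phase.
  exact/derivable1_diffP/derivable_cos.
apply: (@differentiable_comp _ _ _ _ (phase kap) sin).
  exact: differentiable_phase.
exact/derivable1_diffP/derivable_sin.
Qed.

Lemma partial_expi kap mu :
  partial mu (expi kap) = fun x => 'i%C * (kap mu 0)%:C * expi kap x.
Proof.
apply/funext => x; rewrite /partial.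
rewrite (derive_comp_phase cos _ _ _ _ (is_derive_cos _)).
rewrite (derive_comp_phase sin _ _ _ _ (is_derive_sin _)).
rewrite phase_delta /expi; apply/eqP; rewrite eq_complex/=.
by apply/andP; split; apply/eqP; ring.
Qed.

Lemma apply_op_expi (L : wave_op R) kap x :
  apply_op L (expi kap) x =
  (- (\sum_(mu < 4) \sum_(nu < 4)
       coef_a L mu nu * ((kap mu 0)%:C * (kap nu 0)%:C))
   + 'i%C * (\sum_(mu < 4) coef_b L mu 0 * (kap mu 0)%:C)
   + coef_f L x) * expi kap x.
Proof.
rewrite /apply_op !mulrDl; congr (_ + _ + _).
  rewrite mulNr mulr_suml -sumrN; apply: eq_bigr => mu _.
  rewrite mulr_suml -sumrN; apply: eq_bigr => nu _.
  rewrite partial_expi partialZ; last exact: cdifferentiable_expi.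
  rewrite partial_expi; move: (expi kap x) => e.
  have i2 : 'i%C * 'i%C = -1 :> R[i] by rewrite -expr2 sqr_i.
  rewrite (_ : 'i%C * _ * (_ * e) =
    ('i%C * 'i%C) * ((kap mu 0)%:C * (kap nu 0)%:C) * e); last by ring.
  by rewrite i2; ring.
rewrite mulr_sumr mulr_suml; apply: eq_bigr => mu _.
by rewrite partial_expi; move: (expi kap x) => e; ring.
Qed.

Lemma expi_neq0 kap x : expi kap x != 0.
Proof.
rewrite /expi; apply/eqP => -[c0 s0].
have := cos2Dsin2 (phase kap x); rewrite c0 s0 expr0n addr0.
by move/eqP; rewrite eq_sym oner_eq0.
Qed.

End PlaneWaves.

(** * Symbols constant on a mass shell *)

Section MassShell.
Context {R : realType}.

Lemma sum_delta (K : pzRingType) n (F : 'I_n -> K) (p : 'I_n) :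
  \sum_(i < n) F i * (i == p)%:R = F p.
Proof.
rewrite (bigD1 p)//= eqxx mulr1 big1 ?addr0// => i /negbTE ip.
by rewrite ip mulr0.
Qed.

(** The test covectors on the mass shell combine one time and two spatial basis vectors; this lemma
    and the next evaluate the first- and second-order terms on them. *)
Lemma linear_form3 (K : comPzRingType) n (F w : 'I_n -> K) (p q r : 'I_n)
    (s t u : K) :
  (forall i, w i = s * (i == p)%:R + t * (i == q)%:R + u * (i == r)%:R) ->
  \sum_(i < n) F i * w i = s * F p + t * F q + u * F r.
Proof.
move=> wE; rewrite -(sum_delta _ _ F p) -(sum_delta _ _ F q) -(sum_delta _ _ F r).
rewrite !mulr_sumr -!big_split/=; apply: eq_bigr => i _.
by rewrite wE; ring.
Qed.

Lemma quadratic_form3 (K : comPzRingType) n (a : 'M[K]_n) (w : 'I_n -> K)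
    (p q r : 'I_n) (s t u : K) :
  (forall i, w i = s * (i == p)%:R + t * (i == q)%:R + u * (i == r)%:R) ->
  \sum_(i < n) \sum_(j < n) a i j * (w i * w j) =
    s ^+ 2 * a p p + t ^+ 2 * a q q + u ^+ 2 * a r r
    + s * t * (a p q + a q p) + s * u * (a p r + a r p)
    + t * u * (a q r + a r q).
Proof.
move=> wE.
rewrite (eq_bigr (fun i => (s * a i p + t * a i q + u * a i r) * w i)).
  by rewrite (linear_form3 _ _ _ _ _ _ _ _ _ _ wE); ring.
move=> i _; rewrite -(linear_form3 _ _ (a i) w p q r s t u wE) mulr_suml.
by apply: eq_bigr => j _; ring.
Qed.

Definition on_shell (M : R) (kap : 'cV[R]_4) : Prop :=
  kap 0 0 ^+ 2 = M + \sum_(i < 3) kap (lift ord0 i) 0 ^+ 2.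

(** The operator multiplies [expi kap] by f minus this quantity, so the wave is a solution exactly
    when the symbol equals f at every point. *)
Definition symbol (a : 'M[R[i]]_4) (b : 'cV[R[i]]_4) (kap : 'cV[R]_4) : R[i] :=
  (\sum_(mu < 4) \sum_(nu < 4) a mu nu * ((kap mu 0)%:C * (kap nu 0)%:C))
  - 'i%C * (\sum_(mu < 4) b mu 0 * (kap mu 0)%:C).

(** With coordinates (time, direction [i], direction [j]), the points used are (+-sqrt(M+1), +-1, 0)
    for [b], the time-space terms and the diagonal, (sqrt M, 0, 0) for [f], and (sqrt(M+2), 1, 1)
    for the spatial off-diagonal terms. *)
Lemma symbol_on_shell (M : R) a b (f : R[i]) : 0 <= M ->
  (forall kap, on_shell M kap -> symbol a b kap = f) ->
  [/\ f = M%:C * a 0 0, b = 0 &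
      forall mu nu, a mu nu + a nu mu = 2 * a 0 0 * (Defs.minkowski R mu nu)%:C].
Proof.
move=> M0 shell.
pose vec (i j : 'I_3) (s t u : R) : 'cV[R]_4 := \col_mu
  (s * (mu == ord0)%:R + t * (mu == lift ord0 i)%:R + u * (mu == lift ord0 j)%:R).
pose L (i j : 'I_3) (s t u : R[i]) : R[i] :=
  s ^+ 2 * a ord0 ord0 + t ^+ 2 * a (lift ord0 i) (lift ord0 i)
  + u ^+ 2 * a (lift ord0 j) (lift ord0 j)
  + s * t * (a ord0 (lift ord0 i) + a (lift ord0 i) ord0)
  + s * u * (a ord0 (lift ord0 j) + a (lift ord0 j) ord0)
  + t * u * (a (lift ord0 i) (lift ord0 j) + a (lift ord0 j) (lift ord0 i))
  - 'i%C * (s * b ord0 0 + t * b (lift ord0 i) 0 + u * b (lift ord0 j) 0).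
have shellL i j (s t u : R) : i != j -> s ^+ 2 = M + t ^+ 2 + u ^+ 2 ->
    L i j s%:C t%:C u%:C = f.
  move=> ij sE; rewrite -(shell (vec i j s t u)); last first.
    rewrite /on_shell mxE eqxx !(eq_liftF, lift_eqF) !mulr0 !addr0 mulr1 sE.
    rewrite -addrA; congr (_ + _).
    rewrite (bigD1 i)//= (bigD1 j) 1?eq_sym//= big1 => [|l /andP[li lj]].
      rewrite !mxE !(inj_eq lift_inj) !eqxx (eq_sym j i) (negbTE ij) /=.
      ring.
    rewrite !mxE !(inj_eq lift_inj) (negbTE li) (negbTE lj) /=; ring.
  have vE mu : (vec i j s t u mu 0)%:C = s%:C * (mu == ord0)%:R +
      t%:C * (mu == lift ord0 i)%:R + u%:C * (mu == lift ord0 j)%:R :> R[i].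
    by rewrite mxE !rmorphD !rmorphM !rmorph_nat.
  rewrite /symbol (quadratic_form3 _ _ _ _ _ _ _ _ _ _ vE).
  by rewrite (linear_form3 _ _ _ _ _ _ _ _ _ _ vE).
(* The cyclic successor serves as second direction wherever its coefficient [u] is 0. *)
have other (i : 'I_3) : exists j, i != j.
  by exists (ordS i); case: i => [[|[|[|]]]].
have Csqr (x y : R) : x ^+ 2 = y -> x%:C ^+ 2 = y%:C :> R[i].
  by move=> <-; rewrite rmorphXn.
have two0 : (2 : R[i]) != 0 by rewrite pnatr_eq0.
have i0 : 'i%C != 0 :> R[i] by rewrite neq0Ci.
(* The four points (+-s, +-1) separate the odd, mixed and even parts. *)
have row i : [/\ b ord0 0 = 0, b (lift ord0 i) 0 = 0,
    a ord0 (lift ord0 i) + a (lift ord0 i) ord0 = 0 &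
    (M + 1)%:C * a ord0 ord0 + a (lift ord0 i) (lift ord0 i) = f].
  have [j ij] := other i.
  pose s := Num.sqrt (M + 1).
  have sE : s ^+ 2 = M + 1 by rewrite sqr_sqrtr// addr_ge0.
  have s0 : s%:C != 0 :> R[i].
    apply/eqP => /complexI s0; move/eqP: sE; rewrite s0 expr0n/= eq_sym.
    by rewrite paddr_eq0// oner_eq0 andbF.
  have E1 : L i j s%:C 1 0 = f.
    by apply: (shellL i j s 1 0 ij); rewrite sE expr1n expr0n addr0.
  have E2 : L i j (- s%:C) 1 0 = f.
    rewrite -rmorphN.
    by apply: (shellL i j (-s) 1 0 ij); rewrite sqrrN sE expr1n expr0n addr0.
  have E3 : L i j s%:C (- 1) 0 = f.
    rewrite -(rmorph1 (real_complex R)) -rmorphN.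
    by apply: (shellL i j s (-1) 0 ij); rewrite sE sqrrN expr1n expr0n addr0.
  have E4 : L i j (- s%:C) (- 1) 0 = f.
    rewrite -(rmorph1 (real_complex R)) -!rmorphN.
    by apply: (shellL i j (-s) (-1) 0 ij); rewrite !sqrrN sE expr1n expr0n addr0.
  (* Three signed sums of the four values isolate [b ord0 0], [b (lift ord0 i) 0] and the mixed
     coefficient, with factors 4is, 4i and 4s; each sum vanishes because all four values equal
     [f]. *)
  have b0 : b ord0 0 = 0.
    apply: (mulfI (mulf_neq0 (mulf_neq0 (mulf_neq0 two0 two0) i0) s0)).
    rewrite mulr0 (_ : _ * _ = L i j (- s%:C) 1 0 - L i j s%:C 1 0
      + L i j (- s%:C) (-1) 0 - L i j s%:C (-1) 0); last by rewrite /L; ring.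
    by rewrite E1 E2 E3 E4; ring.
  have bi : b (lift ord0 i) 0 = 0.
    apply: (mulfI (mulf_neq0 (mulf_neq0 two0 two0) i0)).
    rewrite mulr0 (_ : _ * _ = L i j s%:C (-1) 0 - L i j s%:C 1 0
      + L i j (- s%:C) (-1) 0 - L i j (- s%:C) 1 0); last by rewrite /L; ring.
    by rewrite E1 E2 E3 E4; ring.
  have a0i : a ord0 (lift ord0 i) + a (lift ord0 i) ord0 = 0.
    apply: (mulfI (mulf_neq0 (mulf_neq0 two0 two0) s0)).
    rewrite mulr0 (_ : _ * _ = L i j s%:C 1 0 - L i j s%:C (-1) 0
      + L i j (- s%:C) (-1) 0 - L i j (- s%:C) 1 0); last by rewrite /L; ring.
    by rewrite E1 E2 E3 E4; ring.
  split=> //; rewrite -E1 /L a0i b0 bi -(Csqr _ _ sE); ring.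
have [j1 ij1] := other ord0.
have [b0 _ _ _] := row ord0.
(* The point of zero spatial momentum. *)
have fE : f = M%:C * a ord0 ord0.
  rewrite -(shellL ord0 j1 (Num.sqrt M) 0 0 ij1).
    by rewrite -(Csqr (Num.sqrt M) M) ?sqr_sqrtr// /L b0; ring.
  by rewrite sqr_sqrtr// expr0n !addr0.
have diag i : a (lift ord0 i) (lift ord0 i) = - a ord0 ord0.
  have [_ _ _ E] := row i; apply/eqP; rewrite -subr_eq0 opprK; apply/eqP.
  apply: (addrI f); rewrite addr0 -[RHS]E fE rmorphD rmorph1; ring.
have offdiag i j : i != j ->
    a (lift ord0 i) (lift ord0 j) + a (lift ord0 j) (lift ord0 i) = 0.
  move=> ij; have sE : Num.sqrt (M + 2) ^+ 2 = M + 2.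
    by rewrite sqr_sqrtr// addr_ge0.
  have E : L i j (Num.sqrt (M + 2))%:C 1 1 = f.
    apply: (shellL i j (Num.sqrt (M + 2)) 1 1 ij).
    by rewrite sE expr1n -addrA.
  move: E; have [_ bi ai _] := row i; have [_ bj aj _] := row j.
  rewrite /L (Csqr _ _ sE) b0 bi bj ai aj !diag fE rmorphD rmorph_nat => E.
  by apply: (addrI (M%:C * a ord0 ord0)); rewrite addr0 -[RHS]E; ring.
split=> //.
  apply/colP => mu; rewrite mxE.
  by case: (unliftP ord0 mu) => [i|] ->//; have [] := row i.
move=> mu nu; rewrite /Defs.minkowski.
case: (unliftP ord0 mu) => [i|] ->; case: (unliftP ord0 nu) => [j|] ->.
- rewrite (inj_eq lift_inj); have [->|ij] := eqVneq i j.
    by rewrite lift_eqF diag rmorphN rmorph1; ring.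
  by rewrite offdiag// rmorph0 mulr0.
- by rewrite lift_eqF rmorph0 mulr0 addrC; have [] := row i.
- by rewrite eq_liftF rmorph0 mulr0; have [] := row j.
- by rewrite eqxx rmorph1; ring.
Qed.

End MassShell.

(* Only the symmetric part of the coefficient matrix acts on smooth functions,
   because partial derivatives commute. *)
Lemma apply_op_symmetric_part (R : realType) (L : wave_op R) (kappa : R[i])
    (Psi : wavefun R) x :
  (forall mu nu, coef_a L mu nu + coef_a L nu mu =
     2 * kappa * (Defs.minkowski R mu nu)%:C) ->
  coef_b L = 0 -> smooth Psi ->
  apply_op L Psi x = kappa * dalembertian Psi x + coef_f L x * Psi x.
Proof.
move=> aE b0 sPsi; rewrite /apply_op b0 [X in _ + X + _]big1; last first.
  by move=> mu _; rewrite mxE mul0r.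
rewrite addr0; congr (_ + _); rewrite /dalembertian.
pose D mu nu := partial mu (partial nu Psi) x.
have two0 : (2 : R[i]) != 0 by rewrite pnatr_eq0.
apply: (mulfI two0); rewrite [RHS]mulrA [RHS]mulr_sumr.
transitivity (\sum_(mu < 4) \sum_(nu < 4)
    (coef_a L mu nu + coef_a L nu mu) * D mu nu).
  rewrite mulr_natl mulr2n [X in _ + X]exchange_big -big_split/=.
  apply: eq_bigr => mu _; rewrite -big_split/=; apply: eq_bigr => nu _.
  by rewrite mulrDl /D (partial_comm Psi nu mu).
apply: eq_bigr => mu _; rewrite mulr_sumr; apply: eq_bigr => nu _.
by rewrite aE [RHS]mulrA.
Qed.

Theorem theorem4 (R : realType) (m hbar c : R)
    (hm : 0 <= m) (hhbar : 0 < hbar) (hc : 0 < c) :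
  (exists L : wave_op R,
     involves_time L /\ lorentz_covariant c (fun _ _ => 1) L) /\
  (forall L : wave_op R,
     involves_time L ->
     lorentz_covariant c (fun _ _ => 1) L ->
     (forall (k : 'cV[R]_3) (omega : R),
        hbar ^+ 2 * omega ^+ 2
          = m ^+ 2 * c ^+ 4 + c ^+ 2 * hbar ^+ 2 * sqnorm3 k ->
        solution L (plane_wave c k omega)) ->
     exists2 kappa : R[i], kappa != 0 &
       forall Psi : wavefun R, smooth Psi -> forall x : spacetime R,
         apply_op L Psi x = kappa * klein_gordon m hbar c Psi x).
Proof.
split.
  exists dalembertian_op; split.
    left; exists 0; rewrite !mxE /Defs.minkowski eqxx rmorph1.
    by rewrite (_ : 1 + 1 = 2%:R) ?pnatr_eq0.
  split=> [M [MtM _]|M v SO3M hv].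
    by apply/covariant_dalembertian/lorentz_rot4; rewrite trmxK.
  split; [exact: smooth_cst | by move=> x; exact: oner_neq0 |].
  by apply/covariant_dalembertian/lorentz_boost.
move=> L time_L _ waves.
pose M := m ^+ 2 * c ^+ 2 / hbar ^+ 2.
have M0 : 0 <= M by rewrite /M -exprMn divr_ge0 ?sqr_ge0.
have c0 : c != 0 := lt0r_neq0 hc.
have hbar0 : hbar != 0 := lt0r_neq0 hhbar.
(* Every on-shell covector is the wave covector of an admissible plane wave with omega = -c kap_0;
   both signs of omega occur, hence both sheets of the hyperboloid. *)
have dispersion x kap : on_shell M kap ->
    symbol (coef_a L) (coef_b L) kap = coef_f L x.
  move=> shell.
  pose k : 'cV[R]_3 := \col_i kap (lift ord0 i) 0.
  have kapE : wave_covector c k (- (c * kap 0 0)) = kap.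
    apply/colP => mu; rewrite mxE; case: unliftP => [i|] ->.
      by rewrite mxE.
    by rewrite mulNr opprK [c * _]mulrC mulfK.
  have kE : sqnorm3 k = \sum_(i < 3) kap (lift ord0 i) 0 ^+ 2.
    by apply: eq_bigr => i _; rewrite mxE.
  have onshell : hbar ^+ 2 * (- (c * kap 0 0)) ^+ 2
      = m ^+ 2 * c ^+ 4 + c ^+ 2 * hbar ^+ 2 * sqnorm3 k.
    by rewrite kE sqrrN exprMn shell /M; field.
  have /eqP := waves k _ onshell x.
  rewrite plane_wave_expi kapE apply_op_expi mulf_eq0.
  rewrite (negbTE (expi_neq0 kap x)) orbF addrC addr_eq0 => /eqP ->.
  by rewrite opprD opprK.
(* Applied at each [x] separately, this shows that [coef_f L x] is always [M%:C * coef_a L 0 0], so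
   f is constant. *)
have coef x := symbol_on_shell M _ _ _ M0 (dispersion x).
have [_ b0 aE] := coef 0.
(* Were this coefficient zero, all symmetrised second-order coefficients and [b] would vanish,
   contradicting the presence of a time derivative. *)
exists (coef_a L 0 0).
  apply/eqP => a00; case: time_L => [[mu]|]; last by rewrite b0 mxE eqxx.
  by rewrite aE a00 mulr0 mul0r eqxx.
move=> Psi sPsi x; rewrite (apply_op_symmetric_part _ L (coef_a L 0 0))//.
by have [-> _ _] := coef x; rewrite /klein_gordon mulrDr mulrA [M%:C * _]mulrC.
Qed.
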